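(* Let $n\ge 1$, $\lambda>0$ and $U,V\subset\mathbb{R}^n$. Suppose $b:\mathbb{R}^n\to\mathbb{R}^n$ and $f:\mathbb{R}^n\to\mathbb{R}$ are bounded and Lipschitz continuous, and $c:U\to[0,\infty)$, $\chi:V\to[0,\infty)$ satisfy $\inf_{\xi\in U}c(\xi)>0$, $\inf_{\eta\in V}\chi(\eta)>0$, $c(\xi_1+\xi_2)\le c(\xi_1)+c(\xi_2)$ for all $\xi_1,\xi_2\in U$, and $\chi(\eta_1+\eta_2)<\chi(\eta_1)+\chi(\eta_2)$ for all $\eta_1,\eta_2\in V$. Then the lower value function $V^-$ and the upper value function $V^+$ of the two-player zero-sum deterministic impulse control game with data $(b,f,c,\chi,\lambda,U,V)$ are continuous on $\mathbb{R}^n$.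
   Context: Convention: in the conditions on $c$ and $\chi$, sums $\xi_1+\xi_2$ and $\eta_1+\eta_2$ are understood to lie in $U$ and $V$, so that the costs are defined there. The game. An impulse control of player-$\xi$ is a double sequence $u=(\tau_m,\xi_m)_{m\ge1}$, where $(\tau_m)$ is a non-decreasing sequence in $[0,+\infty]$ with $\tau_m\to+\infty$ and $\xi_m\in U$, $\xi_m\ne0$. An impulse control of player-$\eta$ is a double sequence $v=(\rho_k,\eta_k)_{k\ge1}$, where $(\rho_k)$ is a non-decreasing sequence in $[0,+\infty]$ with $\rho_k\to+\infty$ and $\eta_k\in V$, $\eta_k\ne0$. An impulse time $+\infty$ means that the impulse does not take place. The sets of such controls are denoted $\mathcal U$ and $\mathcal V$. Given $x\in\mathbb{R}^n$, $u\in\mathcal U$, $v\in\mathcal V$, the trajectory $y_x(\cdot)$ starts from $y_x(0)=x$ (the state before any impulse at time $0$), satisfies $\dot y_x(t)=b(y_x(t))$ for $t\ne\tau_m$, $t\ne\rho_k$, and jumps according to $$y_x(\tau_m^+)=y_x(\tau_m^-)+\xi_m\prod_{k\ge1}\mathbf 1_{\{\tau_m\ne\rho_k\}},\qquad y_x(\rho_k^+)=y_x(\rho_k^-)+\eta_k$$ (so if both players act at the same time, only the action of player-$\eta$ counts). The gain functional (maximized by player-$\xi$, minimized by player-$\eta$) is $$J(x;u,v)=\int_0^\infty f(y_x(t))e^{-\lambda t}dt-\sum_{m\ge1}c(\xi_m)e^{-\lambda\tau_m}\prod_{k\ge1}\mathbf 1_{\{\tau_m\ne\rho_k\}}+\sum_{k\ge1}\chi(\eta_k)e^{-\lambda\rho_k}.$$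 Strategies and values. $\mathcal A$ is the set of non-anticipative maps $\alpha:\mathcal V\to\mathcal U$: for all $t\ge0$ and $v_1,v_2\in\mathcal V$, if $v_1\equiv v_2$ on $[0,t]$ (same impulses at times $\le t$) then $\alpha(v_1)\equiv\alpha(v_2)$ on $[0,t]$. $\mathcal B$ is the set of non-anticipative maps $\beta:\mathcal U\to\mathcal V$, defined likewise. The value functions are $$V^-(x)=\inf_{\beta\in\mathcal B}\sup_{u\in\mathcal U}J(x;u,\beta(u)),\qquad V^+(x)=\sup_{\alpha\in\mathcal A}\inf_{v\in\mathcal V}J(x;\alpha(v),v).$$ *)

(* Defs.v *)
From HB Require Import structures.
From mathcomp Require Import all_boot all_order all_algebra.
From mathcomp Require Import all_classical all_reals all_analysis.

Set Implicit Arguments.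
Unset Strict Implicit.
Unset Printing Implicit Defensive.

Import Order.TTheory GRing.Theory Num.Theory.
Import numFieldNormedType.Exports.

Local Open Scope classical_set_scope.
Local Open Scope ring_scope.

(* Impulses are indexed from 0. An impulse at time +oo does not take place, but
   its size is still an element of U, so U must have a nonzero element for
   [icontrol U] to be inhabited. *)
Record icontrol (R : realType) (n : nat) (U : set 'rV[R]_n) := IControl {
  itime : nat -> \bar R ;
  isize : nat -> 'rV[R]_n ;
  itime_ge0 : forall m, (0 <= itime m)%E ;
  itime_nondecreasing : nondecreasing_seq itime ;
  itime_cvg : itime @ \oo --> +oo%E ;
  isize_in : forall m, U (isize m) ;
  isize_neq0 : forall m, isize m <> 0 }.

Section game.
Context {R : realType} {n : nat}.
Implicit Types U V : set 'rV[R]_n.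

(* The impulses at times <= t form an initial segment of a control; two controls
   coincide on [0, t] when these initial segments are the same. *)
Definition same_upto U (t : R) (u1 u2 : icontrol U) : Prop :=
  forall m, (itime u1 m <= t%:E)%E \/ (itime u2 m <= t%:E)%E ->
    itime u1 m = itime u2 m /\ isize u1 m = isize u2 m.

Definition nonanticipative U V (alpha : icontrol V -> icontrol U) : Prop :=
  forall (t : R) (v1 v2 : icontrol V), 0 <= t ->
    same_upto t v1 v2 -> same_upto t (alpha v1) (alpha v2).

(* The product over k of the indicators of tau_m <> rho_k is the indicator of
   this proposition. *)
Definition unmatched U V (u : icontrol U) (v : icontrol V) (m : nat) : Prop :=
  forall k, itime u m <> itime v k.

(* Several impulses of one player at the same time are applied one after the
   other, so the jump at t is their sum. Both sums have finite support, since
   impulse times tend to +oo. *)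
Definition jump U V (u : icontrol U) (v : icontrol V) (t : R) : 'rV[R]_n :=
  \sum_(m \in [set m | itime u m = t%:E /\ unmatched u v m]) isize u m +
  \sum_(k \in [set k | itime v k = t%:E]) isize v k.

(* The trajectory is taken left-continuous: y t is the state before the impulses
   at time t. Its values at negative times are irrelevant. *)
Record is_trajectory U V (b : 'rV[R]_n -> 'rV[R]_n) (x : 'rV[R]_n)
    (u : icontrol U) (v : icontrol V) (y : R -> 'rV[R]_n) : Prop := {
  trajectory_init : y 0 = x ;
  trajectory_left : forall t : R, 0 < t -> y s @[s --> t^'-] --> y t ;
  trajectory_right : forall t : R, 0 <= t ->
    y s @[s --> t^'+] --> y t + jump u v t ;
  trajectory_ode : forall t : R, 0 < t ->
    (forall m, itime u m <> t%:E) -> (forall k, itime v k <> t%:E) ->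
    is_derive t 1 y (b (y t)) }.

(* For Lipschitz b the trajectory exists and is unique on [0, +oo[; the default
   value of xget plays no role. *)
Definition trajectory U V (b : 'rV[R]_n -> 'rV[R]_n) (x : 'rV[R]_n)
    (u : icontrol U) (v : icontrol V) : R -> 'rV[R]_n :=
  xget (fun=> 0) [set y | is_trajectory b x u v y].

(* Impulses at time +oo contribute expeR -oo = 0. If both cost series diverge,
   the gain is (-oo) + (+oo) = -oo by the convention of \bar R. *)
Definition gain U V (b : 'rV[R]_n -> 'rV[R]_n) (f c chi : 'rV[R]_n -> R)
    (lambda : R) (x : 'rV[R]_n) (u : icontrol U) (v : icontrol V) : \bar R :=
  (\int[lebesgue_measure]_(t in `[0%R, +oo[)
      (f (trajectory b x u v t) * expR (- (lambda * t)))%:E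
   - \sum_(0 <= m <oo | `[< unmatched u v m >])
      (c (isize u m))%:E * expeR (- (lambda%:E * itime u m))
   + \sum_(0 <= k <oo)
      (chi (isize v k))%:E * expeR (- (lambda%:E * itime v k)))%E.

Definition lower_value U V (b : 'rV[R]_n -> 'rV[R]_n) (f c chi : 'rV[R]_n -> R)
    (lambda : R) (x : 'rV[R]_n) : \bar R :=
  ereal_inf [set ereal_sup [set gain b f c chi lambda x u (beta u)
                            | u in [set: icontrol U]]
            | beta in [set beta : icontrol U -> icontrol V
                      | nonanticipative beta]].

Definition upper_value U V (b : 'rV[R]_n -> 'rV[R]_n) (f c chi : 'rV[R]_n -> R)
    (lambda : R) (x : 'rV[R]_n) : \bar R :=
  ereal_sup [set ereal_inf [set gain b f c chi lambda x (alpha v) v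
                            | v in [set: icontrol V]]
            | alpha in [set alpha : icontrol V -> icontrol U
                       | nonanticipative alpha]].

End game.

Arguments lower_value {R n} U V b f c chi lambda x.
Arguments upper_value {R n} U V b f c chi lambda x.

(* Main.v *)
Require Import Defs.
From HB Require Import structures.
From mathcomp Require Import all_boot all_order all_algebra.
From mathcomp Require Import all_classical all_reals all_analysis.
From mathcomp Require Import measurable_realfun.
From mathcomp Require Import ring lra.

Set Implicit Arguments.
Unset Strict Implicit.
Unset Printing Implicit Defensive.

Import Order.TTheory GRing.Theory Num.Theory.
Import numFieldNormedType.Exports.

Local Open Scope classical_set_scope.
Local Open Scope ring_scope.

(** The two players' costs do not depend on the initial state, and for fixed
    controls the jumps of the trajectory do not either. So two trajectories with
    the same controls differ by a function that is continuous across the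
    impulses and satisfies the differential inequality [|z'| <= L |z|]; it is at
    most [exp (2 L t) |x - x'|] ([trajectory_dist]). Up to a large time the two
    running payoffs are then uniformly close, and after it the discount makes
    both negligible, since [f] is bounded. Hence the gain is uniformly
    continuous in the initial state, uniformly in the controls ([gain_dist]).
    Taking suprema over controls and infima over strategies preserves such an
    estimate, also for extended real values, and both values are continuous.

    The work lies in making sense of the trajectory, whose defining choice is
    arbitrary unless a trajectory exists. A local flow of [b] comes from
    Picard iteration, on a time interval whose length depends only on [L]
    ([local_solution]). Impulse times are locally finite, so a solution can be
    prolonged up to the next impulse, made to jump, and restarted
    ([solution_extend]); a form of induction on the half-line, which examines
    each time together with a small neighbourhood, then reaches all times
    ([local_induction]). The same induction proves the Gronwall estimate
    [solution_dist] without enumerating the impulses.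

    The values are finite because a player who never acts pays no cost: the
    idle maximizer secures at least [- M / lambda], and the idle minimizer at
    most [M / lambda], where [M] bounds [|f|]. *)

(** * Vector-valued functions of time *)

Lemma mx_norm_le (R : realType) (n : nat) (x : 'rV[R]_n) (K : R) : 0 <= K ->
  (forall j, `|x 0 j| <= K) -> `|x| <= K.
Proof.
move=> K0 xK; rewrite /Num.Def.normr/= mx_normrE bigmax_le//= => -[i j] _ /=.
by rewrite (ord1 i).
Qed.

Lemma coord_norm_le (R : realType) (n : nat) (x : 'rV[R]_n) j : `|x 0 j| <= `|x|.
Proof.
rewrite [leRHS]/Num.Def.normr/= mx_normrE.
exact: (le_bigmax _ (fun ij : 'I_1 * 'I_n => `|x ij.1 ij.2|) (0, j)).
Qed.

Lemma is_derive_coord (R : realType) (n : nat) (z : R -> 'rV[R]_n) (t : R)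
    (dz : 'rV[R]_n) j :
  is_derive t 1 z dz -> is_derive t 1 (fun s => z s 0 j) (dz 0 j).
Proof.
move=> zt; have dzt : derivable z t 1 by [].
apply: DeriveDef; first by move/derivable_mxP : dzt; exact.
have : 'D_1 z t = dz by exact: derive_val.
by rewrite derive_mx// => <-; rewrite mxE.
Qed.

Lemma is_derive_row (R : realType) (n : nat) (z : R -> 'rV[R]_n) (t : R)
    (dz : 'rV[R]_n) :
  (forall j, is_derive t 1 (fun s => z s 0 j) (dz 0 j)) -> is_derive t 1 z dz.
Proof.
move=> zt; have dzt : derivable z t 1.
  by apply/derivable_mxP => i j; rewrite (ord1 i); have := zt j => -[].
apply: DeriveDef => //; rewrite derive_mx//; apply/rowP => j; rewrite !mxE.
exact: derive_val.
Qed.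

(** The mean value theorem fails for vector-valued functions, but the norm is
    the maximum of the coordinates, so the inequality reduces to them. *)
Lemma mean_value_le (R : realType) (n : nat) (z dz : R -> 'rV[R]_n) (a b K : R) :
  a <= b -> {within `[a, b], continuous z} ->
  (forall t, a < t < b -> is_derive t 1 z (dz t)) ->
  (forall t, a < t < b -> `|dz t| <= K) ->
  `|z b - z a| <= K * (b - a).
Proof.
rewrite le_eqVlt => /predU1P[-> _ _ _|ab cz zt dzK].
  by rewrite !subrr normr0 mulr0.
have K0 : 0 <= K by rewrite (le_trans _ (dzK ((a + b) / 2) _))// !midf_lt.
apply: mx_norm_le => [|j]; first by rewrite mulr_ge0// subr_ge0 ltW.
have [||c cab] := @MVT R (fun s => z s 0 j) (fun s => dz s 0 j) a b ab.
- by move=> x xab; apply: is_derive_coord; apply: zt; rewrite in_itv in xab.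
- move=> x; apply: (@continuous_comp (subspace `[a, b]) _ _ z
    (fun M : 'rV[R]_n => M 0 j)); [exact: cz|exact: coord_continuous].
rewrite !mxE => ->; rewrite normrM [X in _ * X]gtr0_norm ?subr_gt0//.
rewrite ler_pM2r ?subr_gt0// (le_trans (coord_norm_le _ _))//.
by apply: dzK; rewrite in_itv in cab.
Qed.

Lemma is_derive_continuous (R : realType) (n : nat) (z : R -> 'rV[R]_n) (t : R)
    (dz : 'rV[R]_n) :
  is_derive t 1 z dz -> {for t, continuous z}.
Proof.
by move=> zt; apply/differentiable_continuous/derivable1_diffP.
Qed.

Lemma is_derive_translate (R : realType) (n : nat) (z : R -> 'rV[R]_n)
    (t a : R) (l : 'rV[R]_n) :
  is_derive (t - a) 1 z l -> is_derive t 1 (fun s => z (s - a)) l.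
Proof.
move=> zl; apply: is_derive_row => j; rewrite -[l 0 j]mulr1.
by apply: (@is_derive1_comp R (fun s => z s 0 j) (shift (- a)) t);
  [exact: is_derive_coord|exact: is_derive_shift].
Qed.

(** If the derivative of a continuous function has a limit at [t], it is the
    derivative at [t]: apply the mean value inequality to [y s - s l] on both
    sides of [t]. It shows that two solutions glued at a time without impulse
    satisfy the equation at that time. *)
Lemma is_derive_punctured (R : realType) (n : nat) (y dy : R -> 'rV[R]_n)
    (t d : R) (l : 'rV[R]_n) : 0 < d -> {for t, continuous y} ->
  (forall s, `|s - t| < d -> s != t -> is_derive s 1 y (dy s)) ->
  dy s @[s --> t^'] --> l -> is_derive t 1 y l.
Proof.
move=> d0 cy ydy dyl.
suff yl : h^-1 *: ((y \o shift t) (h *: 1) - y t) @[h --> 0^'] --> l.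
  by apply: DeriveDef; [apply/cvg_ex; exists l|exact/cvg_lim].
pose z (s : R) := y s - s *: l.
have dz (s : R) : `|s - t| < d -> s != t -> is_derive s 1 z (dy s - l).
  move=> st snt; apply: is_deriveB; first exact: ydy.
  apply: is_derive_row => j.
  rewrite (_ : (fun s => _) = (fun s => s * l 0 j)).
    by apply: is_derive_eq; rewrite /GRing.scale/= mulr1 mulr0 add0r.
  by apply/funext => r; rewrite mxE.
apply/(@cvgrPdist_le _ _ _ (0^')) => e e0.
have /(@cvgrPdist_le _ _ _ (t^'))/(_ e e0)[r/= r0 rdy] := dyl.
exists (Num.min d r) => /=; first by rewrite lt_min d0.
move=> h/=; rewrite sub0r normrN => hdr h0.
have dzle (s : R) : `|s - t| < Num.min d r -> s != t -> `|dy s - l| <= e.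
  rewrite lt_min => /andP[_ sr] snt; rewrite distrC; apply: rdy => //=.
  by rewrite distrC.
have cz (s : R) : `|s - t| < Num.min d r -> {for s, continuous z}.
  rewrite lt_min => /andP[sd _]; have [->|snt] := eqVneq s t.
    apply: cvgB; first exact: cy.
    by apply: cvgZr_tmp; exact: cvg_id.
  exact: is_derive_continuous (dz s sd snt).
have key (u v : R) : u < v ->
    (forall s, u <= s <= v -> `|s - t| < Num.min d r) ->
    (forall s, u < s < v -> s != t) -> `|z v - z u| <= e * (v - u).
  move=> uv near_t ne_t.
  have near_t' s : u < s < v -> `|s - t| < Num.min d r.
    by move=> /andP[us sv]; apply: near_t; rewrite !ltW.
  apply: (@mean_value_le _ _ z (fun s => dy s - l)).
  - exact: ltW.
  - apply: continuous_in_subspaceT => s; rewrite inE/= in_itv/= => sI.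
    by apply: cz; exact: near_t.
  - move=> s sI; have := near_t' _ sI; rewrite lt_min => /andP[sd _].
    by apply: dz => //; exact: ne_t.
  - by move=> s sI; apply: dzle; [exact: near_t'|exact: ne_t].
have {}key : `|z (h + t) - z t| <= e * `|h|.
  move: hdr; case: (ltgtP h 0) h0 => // hs _.
    rewrite ltr0_norm// => hdr; rewrite distrC.
    rewrite (_ : - h = t - (h + t)); last by ring.
    apply: key => [|s sI|s sI]; first lra.
      by rewrite ltr_norml; lra.
    by apply/negP => /eqP ?; lra.
  rewrite gtr0_norm// => hdr; rewrite -{2}(addrK t h).
  apply: key => [|s sI|s sI]; first lra.
    by rewrite ltr_norml; lra.
  by apply/negP => /eqP ?; lra.
rewrite distrC (_ : _ - l = h^-1 *: (z (h + t) - z t)).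
  rewrite normrZ normfV ler_pdivrMl ?normr_gt0//.
  by rewrite mulrC.
by apply/rowP => j; rewrite !mxE /GRing.scale/= mulr1; field.
Qed.

(** * Induction on the half-line *)

(** Induction along the half-line: it suffices that each time [S] has a
    neighbourhood in which [P] propagates to the right, along intervals that do
    not have [S] in their interior. Stopping at [S] is what makes the principle
    fit locally finite exceptional sets: near [S] only [S] can be exceptional,
    so these intervals contain no exceptional time in their interior. *)
Lemma local_induction (R : realType) (P : R -> Prop) : P 0 ->
  (forall S : R, 0 <= S -> exists2 d : R, 0 < d & forall s t : R, 0 <= s -> s < t ->
    S - d < s -> t < S + d -> ~ (s < S < t) -> P s -> P t) ->
  forall t : R, 0 <= t -> P t.
Proof.
move=> P0 Pstep T T0; apply: contrapT => nPT.
(* P holds at sup A by a step from its left, and beyond by a step from it. *)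
pose A : set R := [set s | 0 <= s /\ forall r, 0 <= r <= s -> P r].
have A0 : A 0 by split=> // r /le_anti <-.
have AT : ubound A T.
  by move=> s [s0 As]; rewrite leNgt; apply/negP => Ts; apply/nPT/As; lra.
have supA : has_sup A by split; [exists 0|exists T].
have S0 : 0 <= sup A by exact: (ub_le_sup (ex_intro _ T AT)).
have [d d0 step] := Pstep _ S0.
have PltS r : 0 <= r -> r < sup A -> P r.
  move=> r0 rS; have e0 : 0 < sup A - r by rewrite subr_gt0.
  have [s [s0 As] rs] := sup_adherent e0 supA.
  by apply: As; rewrite r0/=; move: rs; rewrite subKr => /ltW.
have PS : P (sup A).
  have [<-//|SS] := eqVneq 0 (sup A).
  have {}S0 : 0 < sup A by rewrite lt_neqAle SS.
  pose s := Num.max 0 (sup A - d / 2).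
  have [s0 sS ds] : [/\ 0 <= s, s < sup A & sup A - d < s].
    rewrite /s le_max lexx gt_max S0/= lt_max; split=> //; first lra.
    by apply/orP; right; lra.
  apply: (step s) => //; [lra|lra|exact: PltS].
have : A (sup A + d / 2).
  split=> [|r /andP[r0 rd]]; first lra.
  have [rS|Sr|->//] := ltgtP r (sup A); first exact: PltS.
  by apply: (step (sup A)) => //; lra.
by move=> /(ub_le_sup (ex_intro _ T AT)); lra.
Qed.

(** * Comparison of impulsive solutions *)

(** Quantifying over all [S], not only over [D], makes [D] closed as well as
    discrete: it meets every bounded interval in a finite set. *)
Definition isolated_times (R : realType) (D : set R) : Prop :=
  forall S : R, exists2 d : R, 0 < d &
    forall r : R, `|r - S| < d -> D r -> r = S.

Section comparison.
Context {R : realType} {n : nat}.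
Variables (b : 'rV[R]_n -> 'rV[R]_n) (D : set R) (J : R -> 'rV[R]_n).

(** Solutions of the impulsive equation with jump [J t] at the times [t] of [D],
    on the closed interval up to [T]. The jump and the equation are only
    required before [T]: the jump at [T] itself starts the continuation, so that
    solutions can be prolonged. *)
Record solution_upto (T : R) (y : R -> 'rV[R]_n) : Prop := {
  solution_left : forall t : R, 0 < t -> t <= T -> y s @[s --> t^'-] --> y t ;
  solution_right : forall t : R, 0 <= t -> t < T -> y s @[s --> t^'+] --> y t + J t ;
  solution_ode : forall t : R, 0 < t -> t < T -> ~ D t -> is_derive t 1 y (b (y t)) }.

Hypothesis D_isolated : isolated_times D.

Lemma solution_upto_le T T' y : T' <= T -> solution_upto T y ->
  solution_upto T' y.
Proof.
by move=> TT [l r o]; split=> t t0 tT; [apply: l|apply: r|apply: o]; lra.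
Qed.

(** The common jump [J] cancels in the difference. *)
Lemma solution_diff_continuous T y1 y2 s t :
  solution_upto T y1 -> solution_upto T y2 -> 0 <= s -> s < t -> t <= T ->
  {within `[s, t], continuous (fun r => y1 r - y2 r)}.
Proof.
move=> S1 S2 s0 st tT.
have lc r : 0 < r -> r <= T -> y1 s - y2 s @[s --> r^'-] --> y1 r - y2 r.
  by move=> r0 rT; apply: cvgB;
    [exact: (solution_left S1)|exact: (solution_left S2)].
have rc r : 0 <= r -> r < T -> y1 s - y2 s @[s --> r^'+] --> y1 r - y2 r.
  move=> r0 rT; rewrite -(addrKA (J r)) opprD addrA -[X in _ --> X]addrA -opprD.
  rewrite (addrC (J r)).
  by apply: cvgB; [exact: (solution_right S1)|exact: (solution_right S2)].
apply/continuous_within_itvP => //; split.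
- move=> r; rewrite in_itv/= => /andP[sr rt]; apply/left_right_continuousP.
  by split; [apply: lc|apply: rc]; lra.
- by apply: rc; lra.
- by apply: lc; lra.
Qed.

Variable L : R.
Hypothesis L_gt0 : 0 < L.
Hypothesis b_lip : forall x y, `|b x - b y| <= L * `|x - y|.

(** Gronwall's inequality on a short interval without impulse, with no
    integration: if [M] is the maximum of the distance, the mean value inequality
    gives [M <= |y1 s - y2 s| + q M] with [q = L (t - s)], and
    [1 <= exp (2 q) (1 - q)] as [q <= 1/2]. *)
Lemma solution_dist_step T y1 y2 s t :
  solution_upto T y1 -> solution_upto T y2 -> 0 <= s -> s < t -> t <= T ->
  (forall r, s < r < t -> ~ D r) -> 2 * L * (t - s) <= 1 ->
  `|y1 t - y2 t| <= expR (2 * L * (t - s)) * `|y1 s - y2 s|.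
Proof.
move=> S1 S2 s0 st tT nD Lts.
have cw := solution_diff_continuous S1 S2 s0 st tT.
have cnw : {within `[s, t], continuous (fun r => `|y1 r - y2 r|)}.
  by move=> x; apply: (@continuous_comp (subspace `[s, t]) _ _
    (fun r => y1 r - y2 r) (fun z => `|z|)); [exact: cw|exact: norm_continuous].
have [r] := EVT_max (ltW st) cnw; rewrite in_itv/= => /andP[sr rt] maxr.
set M := `|y1 r - y2 r| in maxr.
have {}maxr u : s <= u <= t -> `|y1 u - y2 u| <= M.
  by move=> sut; apply: maxr; rewrite in_itv.
have M0 : 0 <= M by exact: normr_ge0.
have : `|(y1 r - y2 r) - (y1 s - y2 s)| <= L * M * (r - s).
  apply: (@mean_value_le _ _ (fun u => y1 u - y2 u)
    (fun u => b (y1 u) - b (y2 u))) => //.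
  - by apply: continuous_subspaceW cw; apply: subset_itvl; rewrite bnd_simp.
  - move=> u /andP[su ur]; have nDu : ~ D u by apply: nD; lra.
    by apply: is_deriveB; [apply: (solution_ode S1)|apply: (solution_ode S2)] => //;
      lra.
  - move=> u /andP[su ur]; rewrite (le_trans (b_lip _ _))// ler_pM2l//.
    by apply: maxr; lra.
move=> wrs.
have MM : M <= `|y1 s - y2 s| + L * M * (t - s).
  rewrite -lerBlDl (le_trans (lerB_dist _ _))// (le_trans wrs)//.
  by apply: ler_wpM2l; [rewrite mulr_ge0// ltW|lra].
apply: (@le_trans _ _ M); first by apply: maxr; lra.
set q := L * (t - s); have q0 : 0 <= q by rewrite mulr_ge0 ?subr_ge0// ltW.
have q1 : 2 * q <= 1 by rewrite mulrA.
have {}MM : M * (1 - q) <= `|y1 s - y2 s| by move: MM; rewrite /q; nra.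
have e1 := expR_ge1Dx (2 * q).
rewrite -mulrA -/q.
apply: (@le_trans _ _ (expR (2 * q) * (M * (1 - q)))); last first.
  by rewrite ler_wpM2l// expR_ge0.
rewrite mulrCA ler_peMr//.
apply: (@le_trans _ _ ((1 + 2 * q) * (1 - q))); first nra.
by rewrite ler_wpM2r//; lra.
Qed.

(** The short-interval estimates multiply. The exponent is [2 L] rather than the
    optimal [L], which is harmless for continuity. *)
Lemma solution_dist T y1 y2 : solution_upto T y1 -> solution_upto T y2 ->
  forall t : R, 0 <= t -> t <= T ->
    `|y1 t - y2 t| <= expR (2 * L * t) * `|y1 0 - y2 0|.
Proof.
move=> S1 S2; apply: local_induction => [_|S S0].
  by rewrite mulr0 expR0 mul1r.
have [d d0 dD] := D_isolated S.
(* Steps within this distance of S have length at most 1 / (2 L). *)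
exists (Num.min d (4 * L)^-1) => [|s t s0 st].
  by rewrite lt_min d0 invr_gt0 mulr_gt0.
rewrite ltrBlDr -ltrBlDl -[in X in _ -> X]ltrBlDl !lt_min.
move=> /andP[sd sL] /andP[td tL] nS IH tT.
have Lts : 2 * L * (t - s) <= 1.
  have e : 2 * L * (2 * (4 * L)^-1) = 1 by field; rewrite gt_eqF.
  by rewrite -[leRHS]e ler_pM2l ?mulr_gt0//; lra.
have nD r : s < r < t -> ~ D r.
  move=> /andP[sr rt] /dD rS; apply: nS; rewrite -rS ?sr//.
  by rewrite ltr_norml; lra.
rewrite (le_trans (solution_dist_step S1 S2 s0 st tT nD Lts))//.
have -> : 2 * L * t = 2 * L * (t - s) + 2 * L * s by ring.
rewrite expRD -[leRHS]mulrA ler_wpM2l ?expR_ge0// IH//.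
by rewrite (le_trans (ltW st)).
Qed.

End comparison.

(** * Local flow by Picard iteration *)

Lemma geometric_half_small (R : realType) (C e : R) : 0 < e ->
  exists k, C * 2^-1 ^+ k < e.
Proof.
move=> e0.
have h1 : `|2^-1 : R| < 1 by rewrite ger0_norm ?invf_lt1 ?ltr1n.
have /cvgrPdist_lt/(_ e e0) [N _ /(_ N (leqnn N))] := cvg_geometric C h1.
by rewrite sub0r normrN => /(le_lt_trans (ler_norm _)) ?; exists N.
Qed.

(** [u k -+ 2 C / 2 ^ k] are monotone sequences that enclose the limit. *)
Lemma geometric_half_limit (R : realType) (u : nat -> R) (C : R) : 0 <= C ->
  (forall k, `|u k.+1 - u k| <= C * 2^-1 ^+ k) ->
  exists l, forall k, `|l - u k| <= 2 * C * 2^-1 ^+ k.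
Proof.
move=> C0 du; pose r k := 2 * C * 2^-1 ^+ k.
have rS k : r k = C * 2^-1 ^+ k + r k.+1 by rewrite /r exprS; field.
have low : {homo (fun k => u k - r k) : j k / (j <= k)%N >-> j <= k}.
  apply/nondecreasing_seqP => k; rewrite (rS k).
  by have := du k; rewrite ler_norml; lra.
have up : {homo (fun k => u k + r k) : j k / (j <= k)%N >-> k <= j}.
  apply/nonincreasing_seqP => k; rewrite (rS k).
  by have := du k; rewrite ler_norml; lra.
have r0 k : 0 <= r k by rewrite !mulr_ge0// exprn_ge0 ?invr_ge0.
have lu j k : u j - r j <= u k + r k.
  apply: (le_trans (low _ _ (leq_maxl j k))).
  apply: le_trans (up _ _ (leq_maxr j k)).
  by have := r0 (maxn j k); lra.
pose A := range (fun k => u k - r k).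
have Ab : ubound A (u 0 + r 0) by move=> _ [j _ <-].
exists (sup A) => k; rewrite -/(r k) ler_norml; apply/andP; split.
  suff : u k - r k <= sup A by lra.
  by apply: ub_le_sup; [exists (u 0 + r 0)|exists k].
suff : sup A <= u k + r k by lra.
by apply: ge_sup => [|_ [j _ <-]]; first by exists (u 0 - r 0), 0.
Qed.

Lemma lip_continuous (R : realType) (V W : normedModType R) (g : V -> W)
    (L : R) : 0 < L -> (forall x y, `|g x - g y| <= L * `|x - y|) -> continuous g.
Proof.
move=> L0 gL x; apply/cvgrPdist_le => e e0.
have : \forall y \near x, `|x - y| <= e / L.
  have /cvgrPdist_le : id @ x --> x by exact: cvg_id.
  by apply; rewrite divr_gt0.
by apply: filterS => y xy; rewrite (le_trans (gL _ _))// -ler_pdivlMl// mulrC.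
Qed.

Section picard.
Context {R : realType} {n : nat}.

(** The integral starts at [-1] so that the primitive is differentiable at [0],
    from where solutions start. *)
Definition primitive (g : R -> 'rV[R]_n) (t : R) : 'rV[R]_n :=
  \row_j (\int[lebesgue_measure]_(s in `[-1, t]) g s 0 j)%R.

Lemma is_derive_primitive (g : R -> 'rV[R]_n) (t : R) :
  continuous g -> -1 < t -> is_derive t 1 (primitive g) (g t).
Proof.
move=> cg t1; apply: is_derive_row => j.
have cgj : continuous (fun s => g s 0 j).
  move=> s; apply: (@continuous_comp _ _ _ g (fun M : 'rV[R]_n => M 0 j)).
    exact: cg.
  exact: coord_continuous.
have tt1 : t < t + 1 by lra.
have gint : lebesgue_measure.-integrable `[-1, t + 1]
    (EFin \o (fun s => g s 0 j)).
  apply: continuous_compact_integrable; first exact: segment_compact.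
  exact: continuous_subspaceT.
have [dP P'] := @continuous_FTC1_closed R (fun s => g s 0 j) (-1) t (t + 1) tt1
  gint t1 (cgj t).
rewrite (_ : (fun s => primitive g s 0 j) =
    fun s => (\int[lebesgue_measure]_(r in [set` `[-1, s]]) g r 0 j)%R).
  by apply: DeriveDef => //; rewrite -derive1E.
by apply/funext => s; rewrite mxE.
Qed.

Variables (b : 'rV[R]_n -> 'rV[R]_n) (L : R).
Hypothesis L_gt0 : 0 < L.
Hypothesis b_lip : forall x y, `|b x - b y| <= L * `|x - y|.

(* On an interval of this length the Picard operator contracts by 1 / 2. *)
Let h := (2 * L)^-1.
Let h_gt0 : 0 < h. Proof. by rewrite invr_gt0 mulr_gt0. Qed.

(** Projection on [[0, h]]. Composing with it makes the Picard operator act on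
    functions on the whole line, for the global uniform distance. *)
Definition clamp (t : R) : R := Num.min (Num.max t 0) h.

Lemma clamp_id t : 0 <= t <= h -> clamp t = t.
Proof. by move=> /andP[t0 th]; rewrite /clamp max_l// min_l. Qed.

Lemma clamp_itv t : 0 <= clamp t <= h.
Proof. by rewrite /clamp le_min le_max lexx orbT/= ge_min lexx orbT ltW. Qed.

Lemma clamp_continuous : continuous clamp.
Proof.
move=> t; apply: (@continuous_min R R (fun s => Num.max s 0) (fun=> h) t).
  by apply: (@continuous_max R R id (fun=> 0) t); [exact: cvg_id|exact: cvg_cst].
exact: cvg_cst.
Qed.

Definition picard (x : 'rV[R]_n) (w : R -> 'rV[R]_n) (t : R) : 'rV[R]_n :=
  x + (primitive (b \o w) (clamp t) - primitive (b \o w) 0).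

Implicit Types w : R -> 'rV[R]_n.

Lemma comp_continuous w : continuous w -> continuous (b \o w).
Proof.
by move=> cw t; apply: continuous_comp; [exact: cw|exact: (lip_continuous L_gt0 b_lip)].
Qed.

Lemma picard_continuous x w : continuous w -> continuous (picard x w).
Proof.
move=> cw t; apply: cvgD; first exact: cvg_cst.
apply: cvgB; last exact: cvg_cst.
apply: (@continuous_comp _ _ _ clamp (primitive (b \o w))).
  exact: clamp_continuous.
apply: is_derive_continuous; apply: is_derive_primitive.
  exact: comp_continuous.
by have := clamp_itv t; lra.
Qed.

Lemma is_derive_picard x w t : continuous w -> 0 < t < h ->
  is_derive t 1 (picard x w) (b (w t)).
Proof.
move=> cw /andP[t0 th].
apply: (@near_eq_is_derive _ _ _
    (fun s => x + (primitive (b \o w) s - primitive (b \o w) 0))) => //.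
  by near=> s; rewrite /picard clamp_id//; apply/andP; split; apply: ltW;
    near: s; [exact: lt_nbhsr|exact: lt_nbhsl].
have -> : b (w t) = 0 + (b (w t) - 0) by rewrite subr0 add0r.
apply: is_deriveD; apply: is_deriveB; apply: is_derive_primitive.
  exact: comp_continuous.
lra.
Unshelve. all: by end_near. Qed.

(** The difference of the images has derivative [b (w1 s) - b (w2 s)], of norm
    at most [L e], on an interval of length at most [h = 1 / (2 L)]. *)
Lemma picard_contraction x w1 w2 e : continuous w1 -> continuous w2 ->
  (forall t, `|w1 t - w2 t| <= e) ->
  forall t, `|picard x w1 t - picard x w2 t| <= e / 2.
Proof.
move=> c1 c2 e12 t.
pose z (s : R) : 'rV[R]_n := primitive (b \o w1) s - primitive (b \o w2) s.
have /andP[t0 th] := clamp_itv t.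
have dz (s : R) : 0 <= s -> is_derive s 1 z (b (w1 s) - b (w2 s)).
  by move=> s0; apply: is_deriveB; apply: is_derive_primitive;
    (exact: comp_continuous || lra).
have e0 : 0 <= e by rewrite (le_trans _ (e12 0)).
have -> : picard x w1 t - picard x w2 t = z (clamp t) - z 0.
  rewrite /picard /z; apply/rowP => j; rewrite !mxE; ring.
apply: (@le_trans _ _ (L * e * (clamp t - 0))).
  apply: (mean_value_le t0 _ (fun s _ => dz s _)).
  - apply: derivable_within_continuous => s; rewrite in_itv/= => /andP[s0 _].
    by have := dz s s0.
  - by move=> s /andP[s0 _]; exact: ltW.
  - by move=> s _; rewrite (le_trans (b_lip _ _))// ler_pM2l.
rewrite subr0 (@le_trans _ _ (L * e * h))//.
  by apply: ler_wpM2l => //; rewrite mulr_ge0// ltW.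
by rewrite /h le_eqVlt; apply/orP; left; apply/eqP; field; rewrite gt_eqF.
Qed.

(** Picard-Lindelof: the iterates converge geometrically and uniformly, so their
    limit is continuous and fixed by the Picard operator. The length [(2 L)^-1]
    does not depend on [x], which is what allows global solutions. *)
Lemma local_solution x : exists2 z : R -> 'rV[R]_n, continuous z /\ z 0 = x &
  forall t, 0 < t < h -> is_derive t 1 z (b (z t)).
Proof.
pose u k := iter k (picard x) (fun=> x).
have cu k : continuous (u k).
  by elim: k => [t|k IH]; [exact: cvg_cst|exact: picard_continuous].
have [C C0 uC] : exists2 C, 0 <= C & forall t, `|u 1%N t - u 0%N t| <= C.
  exists (`|b x| * h) => [|t]; first by rewrite mulr_ge0// ltW.
  have /andP[t0 th] := clamp_itv t.
  have dz (s : R) : 0 <= s -> is_derive s 1 (primitive (b \o (fun=> x))) (b x).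
    move=> s0; apply: (is_derive_primitive (comp_continuous (cu 0%N))); lra.
  rewrite [u 1%N t]/= /picard [u 0%N t]/= addrC addKr.
  apply: (@le_trans _ _ (`|b x| * (clamp t - 0))).
    apply: (mean_value_le t0 _ (fun s _ => dz s _)) => //.
    - apply: derivable_within_continuous => s; rewrite in_itv/= => /andP[s0 _].
      by have := dz s s0.
    - by move=> s /andP[s0 _]; exact: ltW.
  by rewrite subr0 ler_wpM2l.
have du k t : `|u k.+1 t - u k t| <= C * 2^-1 ^+ k.
  elim: k t => [|k IH] t; first by rewrite expr0 mulr1.
  by rewrite exprSr mulrA; exact: (picard_contraction x (cu k.+1) (cu k) IH).
have [z zu] : exists z : R -> 'rV[R]_n,
    forall t k, `|z t - u k t| <= 2 * C * 2^-1 ^+ k.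
  have coord t j : exists l, forall k, `|l - u k t 0 j| <= 2 * C * 2^-1 ^+ k.
    apply: geometric_half_limit => // k; apply: le_trans (du k t).
    by have := coord_norm_le (u k.+1 t - u k t) j; rewrite !mxE.
  exists (fun t => \row_j sval (cid (coord t j))) => t k.
  apply: mx_norm_le => [|j]; first by rewrite !mulr_ge0// exprn_ge0 ?invr_ge0.
  by rewrite !mxE; exact: (svalP (cid (coord t j))).
have small e : 0 < e -> exists k, 2 * C * 2^-1 ^+ k < e.
  exact: geometric_half_small.
have cz : continuous z.
  move=> t; apply/cvgrPdist_le => e e0.
  have [k ke] := small (e / 3) (divr_gt0 e0 (ltr0Sn _ 2)).
  have : \forall s \near t, `|u k t - u k s| <= e / 3.
    by move/cvgrPdist_le : (cu k t); apply; rewrite divr_gt0.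
  apply: filterS => s us.
  have -> : z t - z s = (z t - u k t) + (u k t - u k s) - (z s - u k s).
    by apply/rowP => j; rewrite !mxE; ring.
  rewrite (le_trans (ler_normB _ _))//.
  have := ler_normD (z t - u k t) (u k t - u k s).
  by have := zu t k; have := zu s k; lra.
have zE : picard x z = z.
  apply/funext => t; apply/eqP; rewrite -subr_eq0 -normr_eq0.
  rewrite eq_le normr_ge0 andbT; apply/ler_addgt0Pr => e e0; rewrite add0r.
  have [k ke] := small (e / 2) (divr_gt0 e0 (ltr0Sn _ 1)).
  have r0 : 0 <= 2 * C * 2^-1 ^+ k by rewrite !mulr_ge0// exprn_ge0 ?invr_ge0.
  have -> : picard x z t - z t =
      (picard x z t - picard x (u k) t) - (z t - u k.+1 t).
    by rewrite /u/=; apply/rowP => j; rewrite !mxE; ring.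
  rewrite (le_trans (ler_normB _ _))//.
  have := picard_contraction x cz (cu k) (fun s => zu s k) t.
  by have := zu t k.+1; rewrite exprSr; lra.
exists z.
  split=> //; rewrite -zE /picard clamp_id ?lexx ?ltW//.
  by rewrite subrr addr0.
by move=> t th; rewrite -{1}zE; exact: is_derive_picard.
Qed.

End picard.

(** * Global existence of impulsive solutions *)

Section existence.
Context {R : realType} {n : nat}.
Variables (b : 'rV[R]_n -> 'rV[R]_n) (D : set R) (J : R -> 'rV[R]_n) (L : R).
Hypothesis L_gt0 : 0 < L.
Hypothesis b_lip : forall x y, `|b x - b y| <= L * `|x - y|.
Hypothesis D_isolated : isolated_times D.
Hypothesis J_out : forall t, ~ D t -> J t = 0.

(** After [T], follow the flow of [b] from the state reached by the jump at [T].
    If [T] is not in [D] there is no jump, and the pieces fit smoothly by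
    [is_derive_punctured]. *)
Lemma solution_extend T T' y : solution_upto b D J T y -> 0 <= T -> T < T' ->
  T' - T < (2 * L)^-1 -> (forall r, T < r < T' -> ~ D r) ->
  exists2 y', y' 0 = y 0 & solution_upto b D J T' y'.
Proof.
move=> [yl yr yo] T0 TT' TTh nD.
have [z [cz z0] zo] := local_solution L_gt0 b_lip (y T + J T).
pose y' t := if t <= T then y t else z (t - T).
have y'l t : t <= T -> y' t = y t by move=> tT; rewrite /y' tT.
have y'r t : T < t -> y' t = z (t - T) by move=> tT; rewrite /y' leNgt tT.
have cz' t : z (s - T) @[s --> t] --> z (t - T).
  apply: (@continuous_comp _ _ _ (fun s => s - T) z); last exact: cz.
  by apply: cvgB; [exact: cvg_id|exact: cvg_cst].
have y'L t : 0 < t -> t <= T' -> y' s @[s --> t^'-] --> y' t.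
  move=> t0 tT'; have [tT|Tt] := leP t T.
    rewrite y'l//; apply: cvg_trans (yl t t0 tT); apply: near_eq_cvg.
    near=> s; rewrite y'l// (le_trans _ tT)//; near: s; exact: nbhs_left_le.
  rewrite y'r//.
  apply: cvg_trans (_ : z (s - T) @[s --> t^'-] --> _); last first.
    by apply: cvg_within_filter; exact: cz'.
  apply: near_eq_cvg; near=> s; rewrite y'r//.
have y'R t : 0 <= t -> t < T' -> y' s @[s --> t^'+] --> y' t + J t.
  move=> t0 tT'; have [tT|Tt] := ltP t T.
    rewrite y'l ?ltW//; apply: cvg_trans (yr t t0 tT); apply: near_eq_cvg.
    near=> s; rewrite y'l//; near: s; exact: nbhs_right_le.
  have -> : y' t + J t = z (t - T).
    move: Tt; rewrite le_eqVlt => /predU1P[<-|Tt].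
      by rewrite y'l// subrr z0.
    by rewrite y'r// J_out ?addr0//; apply: nD; rewrite Tt.
  apply: cvg_trans (_ : z (s - T) @[s --> t^'+] --> _); last first.
    by apply: cvg_within_filter; exact: cz'.
  apply: near_eq_cvg; near=> s; rewrite y'r// (le_lt_trans Tt)//.
exists y'; first by rewrite y'l.
split=> // t t0 tT' nDt.
have yo' s : 0 < s -> s < T' -> s != T -> ~ D s -> is_derive s 1 y' (b (y' s)).
  move=> s0 sT' sT nDs; case: (ltgtP s T) sT => // sT _.
    rewrite y'l ?ltW//; apply: (@near_eq_is_derive _ _ _ y) => //.
    - by near=> r; rewrite y'l// ltW//; near: r; exact: lt_nbhsl.
    - exact: yo.
  rewrite y'r//; apply: (@near_eq_is_derive _ _ _ (fun r => z (r - T))) => //.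
  - by near=> r; rewrite y'r//; near: r; exact: lt_nbhsr.
  - by apply: is_derive_translate; apply: zo; lra.
have [tT|tT] := eqVneq t T; last exact: yo'.
have [d d0 dD] := D_isolated t.
have cy' : {for t, continuous y'}.
  apply/left_right_continuousP; split; first by apply: y'L => //; exact: ltW.
  by have := y'R t (ltW t0) tT'; rewrite J_out// addr0.
pose d' := Num.min d (Num.min t (T' - t)).
apply: (@is_derive_punctured _ _ y' (b \o y') t d').
- by rewrite !lt_min d0 t0 subr_gt0.
- exact: cy'.
- move=> s; rewrite !lt_min => /andP[sd /andP[st stT']] snt.
  move: st stT'; rewrite !ltr_norml => ? ?.
  apply: yo'; rewrite -?tT//; [lra|lra|].
  by move=> /(dD _ sd) /eqP; apply/negP.
- apply: cvg_within_filter; apply: (@continuous_comp _ _ _ y' b t).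
    exact: cy'.
  exact: (lip_continuous L_gt0 b_lip).
Unshelve. all: by end_near. Qed.

(** There may be infinitely many impulses in all, but [local_induction] only sees
    the one at [S], and the length of an admissible step depends on [S] alone. *)
Lemma solution_exists x (T : R) : 0 <= T ->
  exists2 y, y 0 = x & solution_upto b D J T y.
Proof.
pose h := (2 * L)^-1; have h0 : 0 < h by rewrite invr_gt0 mulr_gt0.
move: T; apply: local_induction => [|S S0].
  by exists (fun=> x) => //; split=> *; lra.
have [d d0 dD] := D_isolated S.
exists (Num.min d (h / 2)) => [|s t s0 st]; first by rewrite lt_min d0 divr_gt0.
rewrite ltrBlDr -ltrBlDl -[in X in _ -> X]ltrBlDl !lt_min.
move=> /andP[sd sL] /andP[td tL] nS [y y0 ys].
have [||y' y'0 y's] := solution_extend ys s0 st.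
- by rewrite -/h; lra.
- move=> r /andP[sr rt] /dD rS; apply: nS; rewrite -rS ?sr//.
  by rewrite ltr_norml; lra.
by exists y' => //; rewrite y'0.
Qed.

Lemma solution_unique T y1 y2 : solution_upto b D J T y1 ->
  solution_upto b D J T y2 -> y1 0 = y2 0 ->
  forall t : R, 0 <= t -> t <= T -> y1 t = y2 t.
Proof.
move=> S1 S2 y12 t t0 tT; apply/eqP; rewrite -subr_eq0 -normr_le0.
have := solution_dist D_isolated L_gt0 b_lip S1 S2 t0 tT.
by rewrite y12 subrr normr0 mulr0.
Qed.

(** By uniqueness the solutions up to the various [T] agree, so evaluating at [t]
    the one chosen for [T = t] defines a single global solution. *)
Lemma global_solution_exists x :
  exists2 y, y 0 = x & forall T, solution_upto b D J T y.
Proof.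
have ex (T : R) : exists y, 0 <= T -> y 0 = x /\ solution_upto b D J T y.
  have [T0|T0] := leP 0 T; last by exists (fun=> x).
  by have [y y0 ys] := solution_exists x T0; exists y.
have [Y Ys] := choice ex.
pose y t := Y t t.
have yE (T t : R) : 0 <= t -> t <= T -> y t = Y T t.
  move=> t0 tT; have T0 := le_trans t0 tT.
  have [Yt0 Yt] := Ys t t0; have [YT0 YT] := Ys T T0.
  apply: (solution_unique Yt (solution_upto_le tT YT)) => //.
  by rewrite Yt0 YT0.
exists y; first by have [] := Ys 0 (lexx 0).
move=> T; split=> t t0 tT.
- have t1 : 0 <= t + 1 by lra.
  have [_ /solution_left Yl] := Ys (t + 1) t1.
  rewrite (yE (t + 1)); [|lra|lra].
  apply: cvg_trans (Yl t t0 _); last lra.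
  apply: near_eq_cvg; near=> s; rewrite (yE (t + 1))//.
    by apply: ltW; near: s; exact: nbhs_left_gt.
  by rewrite (@le_trans _ _ t)//; lra.
- have t1 : 0 <= t + 1 by lra.
  have [_ /solution_right Yr] := Ys (t + 1) t1.
  rewrite (yE (t + 1)); [|lra|lra].
  apply: cvg_trans (Yr t t0 _); last lra.
  apply: near_eq_cvg; near=> s; rewrite (yE (t + 1))//.
    by rewrite (le_trans t0).
  by near: s; apply: nbhs_right_le; lra.
- have t1 : 0 <= t + 1 by lra.
  move=> nDt; have [_ /solution_ode Yo] := Ys (t + 1) t1.
  rewrite (yE (t + 1)); [|lra|lra].
  apply: (@near_eq_is_derive _ _ _ (Y (t + 1))) => //; last first.
    by apply: Yo => //; lra.
  near=> s; rewrite (yE (t + 1))//; apply: ltW; near: s.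
    exact: lt_nbhsr.
  by apply: lt_nbhsl; lra.
Unshelve. all: by end_near. Qed.

End existence.

(** * Trajectories of the game *)

Lemma countable_setU (T : Type) (A B : set T) :
  countable A -> countable B -> countable (A `|` B).
Proof.
move=> cA cB; rewrite -bigcup2E; apply: bigcup_countable => // i _.
by case: i => [|[|i]].
Qed.

Section impulse_times.
Context {R : realType} {n : nat}.
Implicit Types U V : set 'rV[R]_n.

(** Only finitely many impulses take place up to time [S + 1], because impulse
    times tend to [+oo]. *)
Lemma itime_isolated U (u : icontrol U) (S : R) :
  exists2 d : R, 0 < d &
    forall r m, `|r - S| < d -> itime u m = r%:E -> r = S.
Proof.
have iso N : exists2 d : R, 0 < d & forall r m, (m < N)%N -> `|r - S| < d ->
    itime u m = r%:E -> r = S.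
  elim: N => [|N [d d0 IH]]; first by exists 1.
  have [e e0 eN] : exists2 e : R, 0 < e & forall r, `|r - S| < e ->
      itime u N = r%:E -> r = S.
    have [uS|uS] := eqVneq (itime u N) S%:E.
      by exists 1 => // r _; rewrite uS => -[].
    case uN : (itime u N) uS => [a| |] uS; [|by exists 1..].
    exists `|a - S| => [|r rS [ra]].
      by rewrite normr_gt0 subr_eq0; apply: contra uS => /eqP ->.
    by move: rS; rewrite ra ltxx.
  exists (Num.min d e) => [|r m]; first by rewrite lt_min d0.
  rewrite ltnS leq_eqVlt lt_min => /predU1P[->|mN] /andP[rd re].
    exact: eN.
  exact: IH.
have [N _ uN] := cvgey_ge (itime_cvg u) (S + 1).
have [d d0 dN] := iso N.
exists (Num.min d 1) => [|r m]; first by rewrite lt_min d0 ltr01.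
rewrite lt_min => /andP[rd r1] umr.
have [mN|Nm] := ltnP m N; first exact: dN umr.
have := uN m Nm; rewrite /= umr lee_fin => Sr.
by move: r1; rewrite ltr_norml; lra.
Qed.

Definition impulse_time U V (u : icontrol U) (v : icontrol V) : set R :=
  [set t | (exists m, itime u m = t%:E) \/ (exists k, itime v k = t%:E)].

Lemma impulse_time_isolated U V (u : icontrol U) (v : icontrol V) :
  isolated_times (impulse_time u v).
Proof.
move=> S.
have [d d0 dS] := itime_isolated u S; have [e e0 eS] := itime_isolated v S.
exists (Num.min d e) => [|r]; first by rewrite lt_min d0.
rewrite lt_min => /andP[rd re] [[m um]|[k vk]]; [exact: dS um|exact: eS vk].
Qed.

Lemma countable_impulse_time U V (u : icontrol U) (v : icontrol V) :
  countable (impulse_time u v).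
Proof.
apply: (@sub_countable _ _ _
  (range (fun m => fine (itime u m)) `|` range (fun k => fine (itime v k)))).
  apply: subset_card_le => t [[m um]|[k vk]]; [left|right].
    by exists m => //; rewrite um.
  by exists k => //; rewrite vk.
by apply: countable_setU; exact: sub_countable (card_image_le _ _) _.
Qed.

Lemma jump_out U V (u : icontrol U) (v : icontrol V) t :
  ~ impulse_time u v t -> jump u v t = 0.
Proof.
move=> nt; rewrite /jump.
rewrite (_ : [set m | itime u m = _ /\ _] = set0) ?fsbig_set0 ?add0r.
  rewrite (_ : [set k | itime v k = _] = set0) ?fsbig_set0//.
  by rewrite -subset0 => k vk; apply: nt; right; exists k.
by rewrite -subset0 => m [um _]; apply: nt; left; exists m.
Qed.

Variables (b : 'rV[R]_n -> 'rV[R]_n) (L : R).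
Hypothesis L_gt0 : 0 < L.
Hypothesis b_lip : forall x y, `|b x - b y| <= L * `|x - y|.

(** The trajectory is chosen among all functions that satisfy the defining
    conditions; since one exists, the chosen one satisfies them. *)
Lemma trajectoryP U V x (u : icontrol U) (v : icontrol V) :
  let y := trajectory b x u v in
  y 0 = x /\ forall T, solution_upto b (impulse_time u v) (jump u v) T y.
Proof.
have [y y0 ys] := global_solution_exists L_gt0 b_lip
  (impulse_time_isolated u v) (@jump_out _ _ u v) x.
have yx : is_trajectory b x u v y.
  split=> // t.
  - by move=> t0; exact: (solution_left (ys t)).
  - by move=> t0; apply: (solution_right (ys (t + 1))) => //; lra.
  - move=> t0 nu nv; apply: (solution_ode (ys (t + 1))) => //; first lra.
    by move=> [[m um]|[k vk]]; [exact: nu um|exact: nv vk].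
have [z0 zl zr zo] : is_trajectory b x u v (trajectory b x u v).
  exact: (@xgetPex _ (fun=> 0) [set y | is_trajectory b x u v y]
    (ex_intro _ y yx)).
split=> // T; split=> t t0.
- by move=> _; exact: zl.
- by move=> _; exact: zr.
- move=> _ nt; apply: zo => //.
    by move=> m um; apply: nt; left; exists m.
  by move=> k vk; apply: nt; right; exists k.
Qed.

Lemma trajectory_dist U V x x' (u : icontrol U) (v : icontrol V) t : 0 <= t ->
  `|trajectory b x u v t - trajectory b x' u v t| <=
    expR (2 * L * t) * `|x - x'|.
Proof.
move=> t0; have [y0 ys] := trajectoryP x u v.
have [z0 zs] := trajectoryP x' u v.
rewrite -[in leRHS]y0 -[in leRHS]z0.
exact: (solution_dist (impulse_time_isolated u v) L_gt0 b_lip (ys t) (zs t)).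
Qed.

Lemma measurable_countable (A : set R) (g : R -> R) : countable A ->
  measurable_fun (A : set (measurableTypeR R)) g.
Proof.
move=> cA _ Y _; apply: countable_measurable => //.
exact: sub_countable (subset_card_le (@subIsetl _ _ _)) cA.
Qed.

(** Off the impulse times the trajectory is differentiable, hence continuous, on
    an open set; the remaining times form a countable set, on which every
    function is measurable. *)
Lemma measurable_trajectory U V x (u : icontrol U) (v : icontrol V)
    (f : 'rV[R]_n -> R) : continuous f ->
  measurable_fun (`[0%R, +oo[%classic : set (measurableTypeR R))
    (fun t => f (trajectory b x u v t)).
Proof.
move=> cf; set y := trajectory b x u v; have [_ ys] := trajectoryP x u v.
set D := impulse_time u v; set O : set R := [set t | 0 < t] `\` D.
have oO : open O.
  rewrite openE => t [/= t0 nDt]; have [d d0 dD] := impulse_time_isolated u v t.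
  exists (Num.min d t) => /=; first by rewrite lt_min d0.
  move=> s /=; rewrite distrC lt_min => /andP[sd st]; split=> /=.
    by move: st; rewrite ltr_norml; lra.
  by move=> Ds; apply: nDt; rewrite -(dD s sd Ds).
have mO : measurable (O : set (measurableTypeR R)) by exact: open_measurable.
set C : set R := `[0%R, +oo[ `&` ([set 0] `|` D).
have cC : countable C.
  apply: (@sub_countable _ _ _ ([set 0] `|` D)).
    by apply: subset_card_le => t [].
  by apply: countable_setU; [exact: countable1|exact: countable_impulse_time].
have mC : measurable (C : set (measurableTypeR R)).
  exact: countable_measurable cC.
rewrite (_ : `[0%R, +oo[%classic = O `|` C); last first.
  apply/seteqP; split=> t /=; rewrite in_itv/= andbT.
    rewrite le_eqVlt => /predU1P[<-|t0].
      by right; split; [rewrite /= in_itv/= lexx|left].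
    have [Dt|nDt] := pselect (D t).
      by right; split; [rewrite /= in_itv/= ltW|right].
    by left.
  by move=> [[/= /ltW//]|[]]; rewrite /= in_itv/= andbT.
apply/measurable_funU => //; split; last exact: measurable_countable.
apply: open_continuous_measurable_fun => // t; rewrite inE => -[/= t0 nDt].
apply: continuous_comp; last exact: cf.
apply: (@is_derive_continuous _ _ y t (b (y t))).
by apply: (solution_ode (ys (t + 1))) => //; lra.
Qed.

End impulse_times.

(** * Discounted integrals and continuity in the extended reals *)

Lemma lipschitz_ex (R : realType) (V W : normedModType R) (g : V -> W) :
  lipschitz g -> exists2 L : R, 0 < L & forall x y, `|g x - g y| <= L * `|x - y|.
Proof.
move=> /pinfty_ex_gt0[L L0 gL]; exists L => // x y.
exact: (gL (x, y)).
Qed.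

Lemma bounded_fun_ex (R : realType) (V : Type) (W : normedModType R)
    (g : V -> W) : bounded_fun g -> exists2 M : R, 0 < M & forall x, `|g x| <= M.
Proof.
by move=> /pinfty_ex_gt0[M M0 gM]; exists M => // x; exact: gM.
Qed.

(** Up to the factor [K / a] the integrand is the density of the exponential
    law of rate [a]. *)
Lemma integrable_expdecay (R : realType) (a K : R) : 0 < a ->
  lebesgue_measure.-integrable `[0%R, +oo[%classic
    (fun t : R => (K * expR (- (a * t)))%:E).
Proof.
move=> a0.
have : lebesgue_measure.-integrable `[0%R, +oo[%classic
    (fun t : R => (K / a)%:E * (exponential_pdf a t)%:E)%E.
  apply: integrableZl => //; apply: integrableS (integrable_exponential_pdf _) => //.
apply: eq_integrable => // t; rewrite inE/= in_itv/= andbT => t0.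
rewrite exponential_pdfE// -EFinM mulNr; congr (_%:E); field.
by rewrite gt_eqF.
Qed.

Lemma integral_expdecay (R : realType) (a K : R) : 0 < a ->
  (\int[lebesgue_measure]_(t in `[0%R, +oo[) (K * expR (- (a * t)))%:E)%E
  = (K / a)%:E.
Proof.
move=> a0.
transitivity (\int[lebesgue_measure]_(t in `[0%R, +oo[)
    ((K / a)%:E * (exponential_pdf a t)%:E))%E.
  apply: eq_integral => t; rewrite inE/= in_itv/= andbT => t0.
  rewrite exponential_pdfE// -EFinM mulNr; congr (_%:E); field.
  by rewrite gt_eqF.
rewrite integralZl//; last first.
  by apply: integrableS (integrable_exponential_pdf _).
rewrite integral_mkcond -[RHS]mule1 -(integral_exponential_pdf a0).
congr (_ * _)%E; apply: eq_integral => t _; rewrite patchE.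
case: ifPn => // /negP; rewrite inE/= in_itv/= andbT => /negP.
by rewrite -ltNge => /lt0_exponential_pdf ->.
Qed.

(** The estimate makes [W] finite near any point where it is finite, and locally
    constant where it is infinite; so it yields continuity even for extended real
    values, in particular when one of the players has no control at all. *)
Lemma ereal_unif_continuous (R : realType) (V : normedModType R)
    (W : V -> \bar R) :
  (forall e : R, 0 < e -> exists2 d : R, 0 < d &
    forall x x', `|x - x'| < d -> (W x <= W x' + e%:E)%E) -> continuous W.
Proof.
move=> Wc x.
have near_W (e : R) : 0 < e -> \forall y \near x,
    (W y <= W x + e%:E)%E /\ (W x <= W y + e%:E)%E.
  move=> e0; have [d d0 Wd] := Wc e e0.
  apply/nbhs_normP; exists d => // y /= xy; split; apply: Wd => //.
  by rewrite distrC.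
have near1 := near_W 1 ltr01.
have [[r Wr]|Wr|Wr] : [\/ exists r, W x = r%:E, W x = +oo%E | W x = -oo%E].
  by case: (W x) => [r| |]; [constructor 1; exists r|constructor 2|constructor 3].
- rewrite /continuous_at Wr; apply/fine_cvgP; split.
    apply: filterS near1 => y; rewrite Wr.
    by case: (W y) => [s| |] [].
  apply/cvgrPdist_le => e e0.
  apply: filterS (near_W e e0) => y; rewrite Wr /=.
  case: (W y) => [s| |] [] //=.
  by rewrite -!EFinD !lee_fin ler_norml; lra.
- rewrite /continuous_at Wr; apply: cvg_near_cst.
  by apply: filterS near1 => y; rewrite Wr; case: (W y) => [s| |] [].
- rewrite /continuous_at Wr; apply: cvg_near_cst.
  by apply: filterS near1 => y; rewrite Wr; case: (W y) => [s| |] [].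
Qed.

(** * Gains and values *)

Section gains.
Context {R : realType} {n : nat}.
Variables (U V : set 'rV[R]_n) (b : 'rV[R]_n -> 'rV[R]_n) (f : 'rV[R]_n -> R).
Variables (c chi : 'rV[R]_n -> R) (lambda : R).
Hypothesis lambda_gt0 : 0 < lambda.
Hypothesis b_lipschitz : lipschitz b.
Hypothesis f_bounded : bounded_fun f.
Hypothesis f_lipschitz : lipschitz f.

Definition running x (u : icontrol U) (v : icontrol V) (t : R) : R :=
  f (trajectory b x u v t) * expR (- (lambda * t)).

Lemma measurable_running x u v :
  measurable_fun (`[0%R, +oo[%classic : set (measurableTypeR R))
    (running x u v).
Proof.
have [L L0 bL] := lipschitz_ex b_lipschitz.
have [K K0 fK] := lipschitz_ex f_lipschitz.
apply: measurable_funM.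
  apply: (measurable_trajectory L0 bL).
  exact: lip_continuous K0 fK.
by apply: measurableT_comp => //; apply: measurableT_comp.
Qed.

Lemma running_le x u v (M t : R) : (forall z, `|f z| <= M) ->
  `|running x u v t| <= M * expR (- (lambda * t)).
Proof.
move=> fM; rewrite normrM (ger0_norm (expR_ge0 _)).
by rewrite ler_wpM2r ?expR_ge0.
Qed.

Lemma integrable_running x u v :
  lebesgue_measure.-integrable `[0%R, +oo[%classic
    (fun t => (running x u v t)%:E).
Proof.
have [M M0 fM] := bounded_fun_ex f_bounded.
apply: le_integrable (integrable_expdecay M lambda_gt0) => //.
  by apply/measurable_EFinP; exact: measurable_running.
move=> t _; rewrite !abse_EFin lee_fin (le_trans (running_le _ _ _ _ fM))//.
exact: ler_norm.
Qed.

Lemma integral_running_bound (M : R) : (forall z, `|f z| <= M) -> forall x u v,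
  ((- (M / lambda))%:E <=
   \int[lebesgue_measure]_(t in `[0%R, +oo[) (running x u v t)%:E <=
   (M / lambda)%:E)%E.
Proof.
move=> fM x u v; rewrite -mulNr -!integral_expdecay//; apply/andP; split.
- apply: le_integral => //; [exact: integrable_expdecay|exact: integrable_running|].
  move=> t _; rewrite lee_fin mulNr lerNl (le_trans _ (running_le x u v t fM))//.
  by rewrite -normrN ler_norm.
- apply: le_integral => //; [exact: integrable_running|exact: integrable_expdecay|].
  by move=> t _; rewrite lee_fin (le_trans (ler_norm _))// running_le.
Qed.

(** Half of the discount, [exp (- (lambda / 2) t)], is kept to make the bound
    integrable; the other half absorbs the difference [2 M] of two values of [f]
    after the time [T]. Before [T] the trajectories are close. *)
Lemma running_dist (e : R) : 0 < e -> exists2 d : R, 0 < d &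
  forall x x' u v t, `|x - x'| < d -> 0 <= t ->
    running x u v t <= running x' u v t + e * expR (- (lambda / 2 * t)).
Proof.
move=> e0.
have [L L0 bL] := lipschitz_ex b_lipschitz.
have [K K0 fK] := lipschitz_ex f_lipschitz.
have [M M0 fM] := bounded_fun_ex f_bounded.
pose a := lambda / 2; have a0 : 0 < a by rewrite divr_gt0.
(* After this time 2 M <= e exp (a t), because a t <= exp (a t). *)
pose T := (2 * M / e) / a.
exists (e / (K * expR (2 * L * T))) => [|x x' u v t xx' t0].
  by rewrite divr_gt0// mulr_gt0// expR_gt0.
have -> : expR (- (lambda / 2 * t)) = expR (- (a * t)) by [].
rewrite /running (_ : lambda * t = a * t + a * t); last by rewrite /a; field.
rewrite opprD expRD; set E := expR (- (a * t)).
have E0 : 0 <= E by exact: expR_ge0.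
have E1 : E <= 1 by rewrite -expR0 ler_expR oppr_le0 mulr_ge0// ltW.
set y := f _; set y' := f _; rewrite -lerBlDl -mulrBl.
suff : (y - y') * E <= e by move=> yy; rewrite mulrA ler_wpM2r.
have [tT|Tt] := leP t T.
- have yy : y - y' <= e.
    rewrite (le_trans (ler_norm _))// (le_trans (fK _ _))//.
    have := trajectory_dist L0 bL x x' u v t0; rewrite -(ler_pM2l K0).
    move=> /le_trans; apply; rewrite mulrA.
    have KE0 : 0 < K * expR (2 * L * T) by rewrite mulr_gt0// expR_gt0.
    apply: (@le_trans _ _ (K * expR (2 * L * T) * `|x - x'|)).
      by rewrite ler_wpM2r// ler_pM2l// ler_expR ler_pM2l// mulr_gt0.
    by rewrite -ler_pdivlMl// [leRHS]mulrC ltW.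
  rewrite (le_trans (ler_wpM2r E0 yy))//.
  by rewrite ler_piMr// ltW.
- have yy : y - y' <= 2 * M.
    rewrite (le_trans (ler_norm _))// (le_trans (ler_normB _ _))//.
    by have := fM (trajectory b x u v t); have := fM (trajectory b x' u v t); lra.
  rewrite (le_trans (ler_wpM2r E0 yy))// /E expRN ler_pdivrMr ?expR_gt0//.
  rewrite -ler_pdivrMl// mulrC.
  apply: (@le_trans _ _ (1 + a * t)); last exact: expR_ge1Dx.
  have : 2 * M / e <= a * t by rewrite [leRHS]mulrC -ler_pdivrMr// ltW.
  by lra.
Qed.

(** The cost terms are the same on both sides but may be infinite, so the
    inequality between the integrals is proved first and then translated. *)
Lemma gain_dist (e : R) : 0 < e -> exists2 d : R, 0 < d &
  forall x x' (u : icontrol U) (v : icontrol V), `|x - x'| < d ->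
    (gain b f c chi lambda x u v <= gain b f c chi lambda x' u v + e%:E)%E.
Proof.
move=> e0; have a0 : 0 < lambda / 2 by rewrite divr_gt0.
have ea0 : 0 < e * (lambda / 2) by rewrite mulr_gt0.
have [d d0 dist] := running_dist ea0.
exists d => // x x' u v xx'; rewrite /gain.
rewrite [leRHS]addeAC leeD2r// [leRHS]addeAC leeD2r//.
have <- : (e * (lambda / 2)) / (lambda / 2) = e by field; rewrite gt_eqF.
rewrite -integral_expdecay// -integralD//; last 2 first.
- exact: integrable_running.
- exact: integrable_expdecay.
apply: le_integral => //; first exact: integrable_running.
  by apply: integrableD => //; [exact: integrable_running|exact: integrable_expdecay].
move=> t; rewrite inE/= in_itv/= andbT => t0.
by rewrite -EFinD lee_fin; exact: dist.
Qed.

Lemma lower_value_continuous : continuous (lower_value U V b f c chi lambda).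
Proof.
apply: ereal_unif_continuous => e e0; have [d d0 gd] := gain_dist e0.
exists d => // x x' xx'; rewrite -leeBlDr//.
apply: le_ereal_inf_tmp => _ [beta nb <-]; rewrite leeBlDr//.
apply: ge_ereal_inf; eexists; first by exists beta.
apply: ge_ereal_sup => _ [u _ <-]; rewrite (le_trans (gd x x' u _ xx'))//.
by rewrite leeD2r//; apply: ereal_sup_ubound; exists u.
Qed.

Lemma upper_value_continuous : continuous (upper_value U V b f c chi lambda).
Proof.
apply: ereal_unif_continuous => e e0; have [d d0 gd] := gain_dist e0.
exists d => // x x' xx'.
apply: ge_ereal_sup => _ [alpha na <-]; rewrite -leeBlDr//.
apply: le_ereal_sup_tmp; eexists; first by exists alpha.
apply: le_ereal_inf_tmp => _ [v _ <-]; rewrite leeBlDr//.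
by apply: le_trans (gd x x' _ v xx'); apply: ereal_inf_lbound; exists v.
Qed.


Hypothesis c_ge0 : forall xi, U xi -> 0 <= c xi.
Hypothesis chi_ge0 : forall eta, V eta -> 0 <= chi eta.
Implicit Types (u : icontrol U) (v : icontrol V).

Lemma discount_infty : expeR (- (lambda%:E * +oo)) = 0%E.
Proof. by rewrite gt0_muley ?lte_fin. Qed.

(** An idle minimizer adds nothing to the running payoff, from which the
    maximizer's costs can only be subtracted. *)
Lemma gain_le_idle (M : R) x u v : (forall z, `|f z| <= M) ->
  (forall k, itime v k = +oo%E) ->
  (gain b f c chi lambda x u v <= (M / lambda)%:E)%E.
Proof.
move=> fM vy; rewrite /gain [X in (_ + X)%E]eseries0 ?adde0; last first.
  by move=> k _ _; rewrite vy discount_infty mule0.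
have /andP[_ IM] := integral_running_bound fM x u v.
apply: le_trans IM; apply: geeDl; rewrite oppe_le0.
apply: nneseries_ge0 => m _ _.
by rewrite mule_ge0 ?expeR_ge0// lee_fin c_ge0//; exact: isize_in.
Qed.

Lemma gain_ge_idle (M : R) x u v : (forall z, `|f z| <= M) ->
  (forall m, itime u m = +oo%E) ->
  ((- (M / lambda))%:E <= gain b f c chi lambda x u v)%E.
Proof.
move=> fM uy; rewrite /gain [X in (_ - X + _)%E]eseries0 ?sube0; last first.
  by move=> k _ _; rewrite uy discount_infty mule0.
have /andP[IM _] := integral_running_bound fM x u v.
apply: (le_trans IM); apply: leeDl.
apply: nneseries_ge0 => k _ _.
by rewrite mule_ge0 ?expeR_ge0// lee_fin chi_ge0//; exact: isize_in.
Qed.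

Lemma idle_exists (W : set 'rV[R]_n) : (exists2 w, W w & w <> 0) ->
  exists w : icontrol W, forall m, itime w m = +oo%E.
Proof.
move=> [w Ww w0].
pose never : nat -> \bar R := fun=> +oo%E.
have never_ge0 m : (0 <= never m)%E by exact: leey.
have never_nd : nondecreasing_seq never by [].
have never_cvg : never @ \oo --> +oo%E by exact: cvg_cst.
by exists (@IControl R n W never (fun=> w) never_ge0 never_nd never_cvg
  (fun=> Ww) (fun=> w0)).
Qed.

Lemma nonanticipative_cst (W W' : set 'rV[R]_n) (w : icontrol W') :
  nonanticipative (fun _ : icontrol W => w).
Proof. by move=> t w1 w2 _ _ m. Qed.

Lemma lower_value_fin_num x : (exists2 xi, U xi & xi <> 0) ->
  (exists2 eta, V eta & eta <> 0) ->
  lower_value U V b f c chi lambda x \is a fin_num.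
Proof.
move=> /idle_exists[u0 u0y] /idle_exists[v0 v0y].
have [M _ fM] := bounded_fun_ex f_bounded.
rewrite fin_real//; apply/andP; split.
- apply: (@lt_le_trans _ _ (- (M / lambda))%:E); first exact: ltNyr.
  apply: le_ereal_inf_tmp => _ [beta _ <-].
  apply: (le_trans (gain_ge_idle x (beta u0) fM u0y)).
  by apply: ereal_sup_ubound; exists u0.
- apply: (@le_lt_trans _ _ (M / lambda)%:E); last exact: ltry.
  apply: ge_ereal_inf; eexists.
    by exists (fun=> v0) => //; exact: nonanticipative_cst.
  by apply: ge_ereal_sup => _ [u _ <-]; exact: gain_le_idle.
Qed.

Lemma upper_value_fin_num x : (exists2 xi, U xi & xi <> 0) ->
  (exists2 eta, V eta & eta <> 0) ->
  upper_value U V b f c chi lambda x \is a fin_num.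
Proof.
move=> /idle_exists[u0 u0y] /idle_exists[v0 v0y].
have [M _ fM] := bounded_fun_ex f_bounded.
rewrite fin_real//; apply/andP; split.
- apply: (@lt_le_trans _ _ (- (M / lambda))%:E); first exact: ltNyr.
  apply: le_ereal_sup_tmp; eexists.
    by exists (fun=> u0) => //; exact: nonanticipative_cst.
  by apply: le_ereal_inf_tmp => _ [v _ <-]; exact: gain_ge_idle.
- apply: (@le_lt_trans _ _ (M / lambda)%:E); last exact: ltry.
  apply: ge_ereal_sup => _ [alpha _ <-].
  apply: le_trans (gain_le_idle x (alpha v0) fM v0y).
  by apply: ereal_inf_lbound; exists v0.
Qed.

End gains.

(* The cost functions only matter on U and V. Values lie in \bar R; they are
   real as soon as both players have at least one control. *)
Theorem theorem2 (R : realType) (n : nat) (n_gt0 : (0 < n)%N)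
    (lambda : R) (lambda_gt0 : 0 < lambda) (U V : set 'rV[R]_n)
    (b : 'rV[R]_n -> 'rV[R]_n) (f : 'rV[R]_n -> R)
    (b_bounded : bounded_fun b) (b_lipschitz : lipschitz b)
    (f_bounded : bounded_fun f) (f_lipschitz : lipschitz f)
    (c chi : 'rV[R]_n -> R)
    (c_ge0 : forall xi, U xi -> 0 <= c xi)
    (chi_ge0 : forall eta, V eta -> 0 <= chi eta)
    (c_inf : (0 < ereal_inf [set (c xi)%:E | xi in U])%E)
    (chi_inf : (0 < ereal_inf [set (chi eta)%:E | eta in V])%E)
    (c_subadd : forall xi1 xi2, U xi1 -> U xi2 -> U (xi1 + xi2) ->
      c (xi1 + xi2) <= c xi1 + c xi2)
    (chi_subadd : forall eta1 eta2, V eta1 -> V eta2 -> V (eta1 + eta2) ->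
      chi (eta1 + eta2) < chi eta1 + chi eta2) :
  [/\ continuous (lower_value U V b f c chi lambda),
      continuous (upper_value U V b f c chi lambda) &
      (exists2 xi, U xi & xi <> 0) -> (exists2 eta, V eta & eta <> 0) ->
      forall x, lower_value U V b f c chi lambda x \is a fin_num /\
                upper_value U V b f c chi lambda x \is a fin_num].
Proof.
split.
- exact: lower_value_continuous.
- exact: upper_value_continuous.
- move=> U_nonzero V_nonzero x; split.
    exact: lower_value_fin_num.
  exact: upper_value_fin_num.
Qed.
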